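(* Let $f,F:\mathbb{R}^m\times\mathbb{R}^n\to\mathbb{R}$, let $\mathcal{S}(x):=\arg\min_{y\in\mathbb{R}^n}f(x,y)$, and define the optimistic and pessimistic hyper-objectives $$\varphi_o(x):=\min_{y\in\mathcal{S}(x)}F(x,y),\qquad\varphi_p(x):=\max_{y\in\mathcal{S}(x)}F(x,y).$$ Assume that: (A1) $f$ is $L_f$-smooth and twice differentiable, and for all $x_1,x_2\in\mathbb{R}^m$, $y_1,y_2\in\mathbb{R}^n$, $\|\nabla\nabla_y f(x_1,y_1)-\nabla\nabla_y f(x_2,y_2)\|\le H_f(\|x_1-x_2\|+\|y_1-y_2\|)$; (A2) $\mathcal{S}(x)$ is nonempty, closed and convex for all $x\in\mathbb{R}^m$; (A3) there exists $\tau>0$ such that $\mathrm{dist}(y,\mathcal{S}(x))\le\tau\|\nabla_y f(x,y)\|$ for all $x\in\mathbb{R}^m$, $y\in\mathbb{R}^n$; (B1) $F$ is $M_F$-Lipschitz continuous and $L_F$-smooth; (B2) there exists $x^\star\in\mathbb{R}^m$ such that $\varphi_o(x^\star)>-\infty$ in the optimistic setting (for (i)), respectively $\varphi_p(x^\star)<+\infty$ in the pessimistic setting (for (ii)). Let $L_{\mathcal{S}}=\max\{2H_f\tau(1+9L_f^2\tau^2),\,4L_f^2\tau^2\}$ and $\rho:=M_FL_{\mathcal{S}}+L_F(1+L_{\mathcal{S}})$. Then: (i) the optimistic hyper-objective $\varphi_o$ is $\rho$-weakly concave; (ii) the pessimistic hyper-objective $\varphi_p$ is $\rho$-weakly conv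ex.
   Context: Vector norms are Euclidean and matrix norms are $\ell_2$ operator norms. $\nabla$ is the gradient with respect to the joint variable $(x,y)$, $\nabla_y$ the gradient with respect to $y$, and $\nabla\nabla_y f$ the derivative of $\nabla_y f$ with respect to $(x,y)$. A function is $L$-smooth if it is differentiable with $L$-Lipschitz gradient. $\mathrm{dist}(y,S)=\min_{z\in S}\|y-z\|$. Since $\mathcal{S}(x)$ need not be compact, the min and max defining $\varphi_o,\varphi_p$ are understood as infimum and supremum. A function $g:\mathbb{R}^m\to\mathbb{R}$ is $\rho$-weakly convex if $x\mapsto g(x)+\frac{\rho}{2}\|x\|^2$ is convex, and $\rho$-weakly concave if $-g$ is $\rho$-weakly convex. *)

(* Defs.v *)
From mathcomp Require Import all_boot all_order all_algebra.
From mathcomp Require Import all_classical all_reals all_analysis.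

Set Implicit Arguments.
Unset Strict Implicit.
Unset Printing Implicit Defensive.

Import Order.TTheory GRing.Theory Num.Theory.
Import numFieldNormedType.Exports.
Local Open Scope classical_set_scope.
Local Open Scope ring_scope.

(* R^k is 'rV[R]_k and the joint variable (x, y) is row_mx x y : 'rV[R]_(m + n).
   The library norm `|v| on 'rV[R]_k is the sup norm, hence l2norm below; both
   norms induce the same topology and the same notion of differentiability, so
   closed, differentiable and jacobian are the library's. *)

Definition l2norm {R : realType} {k : nat} (v : 'rV[R]_k) : R :=
  Num.sqrt (\sum_(i < k) v ord0 i ^+ 2).

(* The matrix A stands for the linear map v |-> v *m A on row vectors, which is
   the convention of jacobian. *)
Definition l2opnorm {R : realType} {p q : nat} (A : 'M[R]_(p, q)) : R :=
  sup [set l2norm (v *m A) | v in [set v : 'rV[R]_p | l2norm v <= 1]].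

(* When S is nonempty and closed the inf is attained; on set0 it is 0. *)
Definition l2dist {R : realType} {k : nat} (y : 'rV[R]_k)
    (S : set 'rV[R]_k) : R :=
  inf [set l2norm (y - z) | z in S].

Definition grad {R : realType} {k : nat} (g : 'rV[R]_k -> R) (z : 'rV[R]_k) :
    'rV[R]_k :=
  \row_(i < k) 'D_(delta_mx ord0 i) g z.

Definition joint {R : realType} {m n : nat}
    (f : 'rV[R]_m -> 'rV[R]_n -> R) (z : 'rV[R]_(m + n)) : R :=
  f (lsubmx z) (rsubmx z).

Definition grad_y {R : realType} {m n : nat}
    (f : 'rV[R]_m -> 'rV[R]_n -> R) (z : 'rV[R]_(m + n)) : 'rV[R]_n :=
  grad (f (lsubmx z)) (rsubmx z).

Definition l2lipschitz {R : realType} {k : nat} (M : R)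
    (g : 'rV[R]_k -> R) : Prop :=
  forall z1 z2 : 'rV[R]_k, `|g z1 - g z2| <= M * l2norm (z1 - z2).

Definition smooth {R : realType} {k : nat} (L : R) (g : 'rV[R]_k -> R) : Prop :=
  (forall z : 'rV[R]_k, differentiable g z) /\
  (forall z1 z2 : 'rV[R]_k,
     l2norm (grad g z1 - grad g z2) <= L * l2norm (z1 - z2)).

Definition twice_differentiable {R : realType} {k : nat}
    (g : 'rV[R]_k -> R) : Prop :=
  (forall z : 'rV[R]_k, differentiable g z) /\
  (forall z : 'rV[R]_k, differentiable (grad g) z).

Definition argmin {R : realType} {T : Type} (g : T -> R) : set T :=
  [set y | forall z : T, g y <= g z].

Definition phi_o {R : realType} {m n : nat}
    (f F : 'rV[R]_m -> 'rV[R]_n -> R) (x : 'rV[R]_m) : \bar R :=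
  ereal_inf [set (F x y)%:E | y in argmin (f x)].

Definition phi_p {R : realType} {m n : nat}
    (f F : 'rV[R]_m -> 'rV[R]_n -> R) (x : 'rV[R]_m) : \bar R :=
  ereal_sup [set (F x y)%:E | y in argmin (f x)].

Definition weakly_convex {R : realType} {k : nat} (rho : R)
    (g : 'rV[R]_k -> R) : Prop :=
  convex_function [set: 'rV[R]_k] (fun x => g x + rho / 2 * l2norm x ^+ 2).

Definition weakly_concave {R : realType} {k : nat} (rho : R)
    (g : 'rV[R]_k -> R) : Prop :=
  weakly_convex rho (fun x => - g x).

(* Main.v *)
(** The idea is to compare an arbitrary y in S(t x1 + (1 - t) x2) with points of
   S(x1) and S(x2), where S(x) is the set of minimizers of f(x, .) and
   D = |x1 - x2|. Let y1 be the projection of y on S(x1). Since grad_y f vanishes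
   at (t x1 + (1 - t) x2, y), the error bound (A3) gives
   y1 = y + (1 - t) w with |w| <= L_f tau D. The point y2' = y - t w is such that
   (t x1 + (1 - t) x2, y) divides the segment from (x1, y1) to (x2, y2') in the
   ratio t, and grad_y f vanishes at two of these three points, so that the
   Lipschitz continuity of its Jacobian makes it of order t (D + |w|)^2 at the
   third. By (A3) again, y2' is then within H_f tau / 2 t (D + |w|)^2 of S(x2).
   Comparing the values of F along that segment (smoothness of F), and at y2' and
   its projection (Lipschitz continuity of F), gives the estimate. The hypothesis
   on phi_p at a single point propagates because S is Lipschitz, and phi_o is
   -phi_p for the upper objective -F. *)
Require Import Defs.
From mathcomp Require Import all_boot all_order all_algebra.
From mathcomp Require Import all_classical all_reals all_analysis.
From mathcomp Require Import ring lra.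

Set Implicit Arguments.
Unset Strict Implicit.
Unset Printing Implicit Defensive.

Import Order.TTheory GRing.Theory Num.Theory.
Import numFieldNormedType.Exports.
Local Open Scope classical_set_scope.
Local Open Scope ring_scope.

(** * Euclidean inner product and norm *)

Definition dot {R : realType} {k : nat} (u v : 'rV[R]_k) : R :=
  \sum_(i < k) u ord0 i * v ord0 i.

Lemma dotC (R : realType) k (u v : 'rV[R]_k) : dot u v = dot v u.
Proof. by apply: eq_bigr => i _; rewrite mulrC. Qed.

Lemma dotDl (R : realType) k (u v w : 'rV[R]_k) :
  dot (u + v) w = dot u w + dot v w.
Proof. by rewrite -big_split; apply: eq_bigr => i _; rewrite mxE mulrDl. Qed.

Lemma dotZl (R : realType) k a (u w : 'rV[R]_k) : dot (a *: u) w = a * dot u w.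
Proof. by rewrite mulr_sumr; apply: eq_bigr => i _; rewrite mxE mulrA. Qed.

Lemma dotBl (R : realType) k (u v w : 'rV[R]_k) :
  dot (u - v) w = dot u w - dot v w.
Proof. by rewrite -scaleN1r dotDl dotZl mulN1r. Qed.

Lemma dot0l (R : realType) k (w : 'rV[R]_k) : dot 0 w = 0.
Proof. by rewrite -(scale0r w) dotZl mul0r. Qed.

Lemma dotDr (R : realType) k (u v w : 'rV[R]_k) :
  dot w (u + v) = dot w u + dot w v.
Proof. by rewrite !(dotC w) dotDl. Qed.

Lemma dotZr (R : realType) k a (u w : 'rV[R]_k) : dot w (a *: u) = a * dot w u.
Proof. by rewrite !(dotC w) dotZl. Qed.

Lemma dotvv_ge0 (R : realType) k (v : 'rV[R]_k) : 0 <= dot v v.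
Proof. by apply: sumr_ge0 => i _; rewrite -expr2 sqr_ge0. Qed.

Lemma l2norm_ge0 (R : realType) k (v : 'rV[R]_k) : 0 <= l2norm v.
Proof. exact: sqrtr_ge0. Qed.

Lemma sqr_l2norm (R : realType) k (v : 'rV[R]_k) : l2norm v ^+ 2 = dot v v.
Proof.
have -> : dot v v = \sum_(i < k) v ord0 i ^+ 2.
  by apply: eq_bigr => i _; rewrite expr2.
by rewrite sqr_sqrtr// sumr_ge0// => i _; rewrite sqr_ge0.
Qed.

Lemma l2normZ (R : realType) k a (v : 'rV[R]_k) :
  l2norm (a *: v) = `|a| * l2norm v.
Proof.
apply: (@pexpIrn _ 2) => //; rewrite ?nnegrE ?mulr_ge0 ?l2norm_ge0//.
by rewrite exprMn !sqr_l2norm dotZl dotZr mulrA real_normK ?num_real// expr2.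
Qed.

Lemma l2normN (R : realType) k (v : 'rV[R]_k) : l2norm (- v) = l2norm v.
Proof. by rewrite -scaleN1r l2normZ normrN1 mul1r. Qed.

Lemma l2norm0 (R : realType) k : l2norm (0 : 'rV[R]_k) = 0.
Proof. by rewrite -(scale0r 0) l2normZ normr0 mul0r. Qed.

Lemma l2norm_eq0 (R : realType) k (v : 'rV[R]_k) : l2norm v = 0 -> v = 0.
Proof.
move=> v0; have : dot v v = 0 by rewrite -sqr_l2norm v0 expr0n.
move/eqP; rewrite psumr_eq0 => [/allP v0i|i _]; last by rewrite -expr2 sqr_ge0.
apply/rowP => i; rewrite mxE; apply/eqP.
by have := v0i i (mem_index_enum _); rewrite mulf_eq0 orbb.
Qed.

Lemma cauchy_schwarz (R : realType) k (u v : 'rV[R]_k) :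
  dot u v <= l2norm u * l2norm v.
Proof.
have [/eqP/l2norm_eq0->|u0] := boolP (l2norm u == 0).
  by rewrite dot0l l2norm0 mul0r.
have [/eqP/l2norm_eq0->|v0] := boolP (l2norm v == 0).
  by rewrite dotC dot0l l2norm0 mulr0.
have uv0 : 0 < l2norm u * l2norm v.
  by rewrite mulr_gt0// lt_neqAle eq_sym l2norm_ge0 ?u0 ?v0.
(* With the norms written |u| and |v|, expanding this square gives 2 |u|^2 |v|^2 - 2 |u| |v|
   [dot u v] >= 0, from which the positive factor |u| |v| is cancelled. *)
have := dotvv_ge0 (l2norm v *: u - l2norm u *: v).
rewrite -scaleNr !(dotDl, dotDr, dotZl, dotZr) (dotC v u) -!sqr_l2norm.
move=> h; rewrite -(ler_pM2l uv0); nra.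
Qed.

Lemma ler_l2normD (R : realType) k (u v : 'rV[R]_k) :
  l2norm (u + v) <= l2norm u + l2norm v.
Proof.
rewrite -(@ler_pXn2r _ 2)// ?nnegrE ?addr_ge0 ?l2norm_ge0//.
rewrite sqr_l2norm !(dotDl, dotDr) (dotC v u) sqrrD !sqr_l2norm.
have := cauchy_schwarz u v; lra.
Qed.

Lemma l2norm_sum (R : realType) k (I : Type) (r : seq I) (v : I -> 'rV[R]_k) :
  l2norm (\sum_(i <- r) v i) <= \sum_(i <- r) l2norm (v i).
Proof.
elim: r => [|i r ih]; first by rewrite !big_nil l2norm0.
by rewrite !big_cons (le_trans (ler_l2normD _ _))// lerD2l.
Qed.

Lemma ler_coord_l2norm (R : realType) k (v : 'rV[R]_k) i :
  `|v ord0 i| <= l2norm v.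
Proof.
rewrite -(@ler_pXn2r _ 2)// ?nnegrE ?l2norm_ge0// real_normK ?num_real//.
rewrite sqr_l2norm /dot (bigD1 i)//= expr2 lerDl.
by apply: sumr_ge0 => j _; rewrite -expr2 sqr_ge0.
Qed.

(** Bridge to the sup norm of the library, in which [bounded_set] is expressed. *)
Lemma ler_norm_l2norm (R : realType) k (v : 'rV[R]_k) : `|v| <= l2norm v.
Proof.
rewrite [leLHS]mx_normrE; apply: (big_ind (fun x => x <= l2norm v)).
- exact: l2norm_ge0.
- by move=> x y xv yv; rewrite ge_max xv.
- by move=> [i j] _ /=; rewrite ord1 ler_coord_l2norm.
Qed.

Lemma sqr_l2norm_row_mx (R : realType) k l (u : 'rV[R]_k) (v : 'rV[R]_l) :
  l2norm (row_mx u v) ^+ 2 = l2norm u ^+ 2 + l2norm v ^+ 2.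
Proof.
rewrite !sqr_l2norm /dot big_split_ord/=; congr (_ + _).
  by apply: eq_bigr => i _; rewrite row_mxEl.
by apply: eq_bigr => i _; rewrite row_mxEr.
Qed.

Lemma l2norm_row_mx0l (R : realType) k l (v : 'rV[R]_l) :
  l2norm (row_mx (0 : 'rV[R]_k) v) = l2norm v.
Proof.
apply: (@pexpIrn _ 2) => //; rewrite ?nnegrE ?l2norm_ge0//.
by rewrite sqr_l2norm_row_mx l2norm0 expr0n add0r.
Qed.

Lemma l2norm_row_mx0r (R : realType) k l (u : 'rV[R]_k) :
  l2norm (row_mx u (0 : 'rV[R]_l)) = l2norm u.
Proof.
apply: (@pexpIrn _ 2) => //; rewrite ?nnegrE ?l2norm_ge0//.
by rewrite sqr_l2norm_row_mx l2norm0 expr0n addr0.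
Qed.

Lemma l2norm_row_mx_le (R : realType) k l (u : 'rV[R]_k) (v : 'rV[R]_l) :
  l2norm (row_mx u v) <= l2norm u + l2norm v.
Proof.
have -> : row_mx u v = row_mx u 0 + row_mx 0 v.
  by rewrite add_row_mx addr0 add0r.
by rewrite (le_trans (ler_l2normD _ _))// l2norm_row_mx0l l2norm_row_mx0r.
Qed.

Lemma l2norm_rsubmx_le (R : realType) k l (z : 'rV[R]_(k + l)) :
  l2norm (rsubmx z) <= l2norm z.
Proof.
rewrite -(@ler_pXn2r _ 2)// ?nnegrE ?l2norm_ge0//.
by rewrite -[in leRHS](hsubmxK z) sqr_l2norm_row_mx lerDr sqr_ge0.
Qed.

(** * The operator norm *)

Lemma l2norm_mulmx_has_sup (R : realType) p q (A : 'M[R]_(p, q)) :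
  has_sup [set l2norm (v *m A) | v in [set v : 'rV[R]_p | l2norm v <= 1]].
Proof.
split; first by exists (l2norm (0 *m A)), 0 => //=; rewrite l2norm0.
(* [v *m A] combines the rows of [A] with coefficients at most 1 in absolute value. Boundedness
   keeps the [sup] in [l2opnorm] from being a default value. *)
exists (\sum_(i < p) l2norm (row i A)) => _ [v /= v1 <-].
rewrite mulmx_sum_row (le_trans (l2norm_sum _ _))//.
apply: ler_sum => i _; rewrite l2normZ ler_piMl ?l2norm_ge0//.
exact: le_trans (ler_coord_l2norm _ _) v1.
Qed.

Lemma l2opnorm_ge0 (R : realType) p q (A : 'M[R]_(p, q)) : 0 <= l2opnorm A.
Proof.
apply: sup_upper_bound; first exact: l2norm_mulmx_has_sup.
by exists 0; rewrite /= ?mul0mx l2norm0.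
Qed.

Lemma ler_l2norm_mulmx (R : realType) p q (v : 'rV[R]_p) (A : 'M[R]_(p, q)) :
  l2norm (v *m A) <= l2opnorm A * l2norm v.
Proof.
have [/eqP/l2norm_eq0->|v0] := boolP (l2norm v == 0).
  by rewrite mul0mx !l2norm0 mulr0.
have v_gt0 : 0 < l2norm v by rewrite lt_neqAle eq_sym v0 l2norm_ge0.
rewrite -ler_pdivrMr//; apply: sup_upper_bound.
  exact: l2norm_mulmx_has_sup.
exists ((l2norm v)^-1 *: v) => /=.
  by rewrite l2normZ gtr0_norm ?invr_gt0// mulVf.
by rewrite -scalemxAl l2normZ gtr0_norm ?invr_gt0// mulrC.
Qed.

(** * Attainment of the distance to a closed set *)

Lemma l2norm_continuous (R : realType) k : continuous (@l2norm R k).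
Proof.
move=> v; apply: continuous_comp; last exact: sqrt_continuous.
apply: (@continuous_big _ _ _ _ predT add_continuous _ (index_enum 'I_k)
  (fun i (w : 'rV[R]_k) => w ord0 i ^+ 2)) => i _ w.
apply: (@continuous_comp _ _ _ (fun w : 'rV[R]_k => w ord0 i)
  (fun x : R => x ^+ 2)).
  exact: coord_continuous.
exact: exprn_continuous.
Qed.

(** [S] need not be bounded, so it is cut down to its points no farther from [y] than some [z0] in
    [S]. This part is compact, the extreme value theorem gives a closest point there, and the
    discarded points are farther than [z0]. *)
Lemma l2dist_attained (R : realType) k (y : 'rV[R]_k) (S : set 'rV[R]_k) :
  S !=set0 -> closed S -> exists2 z, S z & l2norm (z - y) = l2dist y S.
Proof.
move=> [z0 Sz0] clS.
pose B := S `&` [set z | l2norm (y - z) <= l2norm (y - z0)].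
have cont : continuous (fun z : 'rV[R]_k => l2norm (y - z)).
  move=> z.
  apply: (@continuous_comp _ _ _ (fun z : 'rV[R]_k => y - z) (@l2norm R k)).
    by apply: continuousB; [exact: cst_continuous|exact: cvg_id].
  exact: l2norm_continuous.
have clB : closed B.
  apply: closedI => //.
  exact: (iffLR (continuous_closedP _) cont) (@closed_le _ (l2norm (y - z0))).
have bdB : bounded_set B.
  exists (l2norm y + l2norm (y - z0)); split; first exact: num_real.
  move=> M ltM z [_ /= zB]; apply/ltW/(le_lt_trans (ler_norm_l2norm z)).
  apply: le_lt_trans ltM; rewrite -[in leLHS](subKr y z).
  by rewrite (le_trans (ler_l2normD _ _))// l2normN lerD2l.
have [z /set_mem[Sz zB] zmin] := @EVT_min_rV _ _ _ B
  (ex_intro _ z0 (conj Sz0 (lexx _))) (bounded_closed_compact bdB clB)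
  (continuous_subspaceT cont).
exists z => //; rewrite -l2normN opprB.
apply/eqP; rewrite eq_le; apply/andP; split.
  apply: lb_le_inf; first by exists (l2norm (y - z)), z.
  move=> _ [w Sw <-].
  have [wB|/ltW wB] := leP (l2norm (y - w)) (l2norm (y - z0)).
    by apply: zmin; apply/mem_set.
  exact: le_trans wB.
apply: ge_inf; last by exists z.
by exists 0 => _ [w _ <-]; exact: l2norm_ge0.
Qed.

(** * Interpolation inequalities along a segment *)

Lemma derivative_interp (R : realType) (h dh : R -> R) (K t : R) :
    (forall s : R, is_derive s 1 h (dh s)) ->
    (forall s s', s <= s' -> dh s - dh s' <= K * (s' - s)) ->
    0 < t < 1 ->
  h t <= t * h 1 + (1 - t) * h 0 + K / 2 * (t * (1 - t)).
Proof.
move=> hdh dhK /andP[t0 t1].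
(* Adding K s^2 / 2 makes the derivative nondecreasing. *)
pose k s := h s + K / 2 * s ^+ 2.
have kd (s : R) : is_derive s 1 k (dh s + K * s).
  apply: is_derive_eq.
  rewrite (_ : (K / 2) *: _ = K / 2 * (s * 1 + s * 1))//; lra.
have kc a b : {within `[a, b], continuous k}.
  by apply: derivable_within_continuous => s _; exact: ex_derive.
have [c1 /andP[_ c1t] E1] := MVT t0 (fun s _ => kd s) (kc 0 t).
have [c2 /andP[tc2 _] E2] := MVT t1 (fun s _ => kd s) (kc t 1).
move: c1t tc2 E1 E2; rewrite !bnd_simp /k => c1t tc2 E1 E2.
have := dhK c1 c2 (le_trans (ltW c1t) (ltW tc2)) => Hc.
(* Taking (1 - t) [E1] from t [E2] leaves t k(1) + (1 - t) k(0) - k(t) on one side and the quantity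
   of [A] on the other. The terms K s^2 / 2 in k then contribute K / 2 (t - t^2). *)
have A : 0 <= t * (1 - t) * (dh c2 + K * c2 - (dh c1 + K * c1)).
  by rewrite mulr_ge0// ?mulr_ge0//; lra.
have {}E1 := congr1 ( *%R (1 - t)) E1.
have {}E2 := congr1 ( *%R t) E2.
lra.
Qed.

(** The two difference quotients are the same function of the increment, so derivability in the
    single direction [d] suffices and no chain rule is invoked. *)
Lemma is_derive_line (R : realType) k (g : 'rV[R]_k -> R) (q d : 'rV[R]_k)
    (s : R) :
  derivable g (q + s *: d) d ->
  is_derive s 1 (fun s : R => g (q + s *: d)) ('D_d g (q + s *: d)).
Proof.
move=> dg.
have E : (fun h : R => h^-1 *: (((fun s => g (q + s *: d)) \o shift s) (h *: 1)
      - g (q + s *: d)))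
    = (fun h => h^-1 *: ((g \o shift (q + s *: d)) (h *: d) - g (q + s *: d))).
  by apply/funext => h /=; rewrite [h%:A]mulr1 scalerDl addrCA.
by split; rewrite /derivable /derive E.
Qed.

(** Only a bound on how fast the directional derivative may decrease along the segment is required.
    This serves both the smooth function F and the scalar components of [grad_y f]. *)
Lemma segment_interp (R : realType) k (g : 'rV[R]_k -> R) (p q : 'rV[R]_k)
    (K t : R) :
    (forall z, derivable g z (p - q)) ->
    (forall s s', s <= s' ->
      'D_(p - q) g (q + s *: (p - q)) - 'D_(p - q) g (q + s' *: (p - q))
      <= K * (s' - s)) ->
    0 < t < 1 ->
  g (t *: p + (1 - t) *: q)
    <= t * g p + (1 - t) * g q + K / 2 * (t * (1 - t)).
Proof.
move=> dg gK t01.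
have := derivative_interp (fun s => is_derive_line (dg _)) gK t01.
rewrite scale1r scale0r addr0 subrKC.
suff -> : q + t *: (p - q) = t *: p + (1 - t) *: q by [].
by rewrite scalerBr scalerBl scale1r addrCA.
Qed.

Lemma derive_grad (R : realType) k (g : 'rV[R]_k -> R) (z d : 'rV[R]_k) :
  differentiable g z -> 'D_d g z = dot (grad g z) d.
Proof.
move=> dg; rewrite deriveE// [in LHS](row_sum_delta d) linear_sum/=.
apply: eq_bigr => i _.
by rewrite linearZ/= /grad mxE deriveE// mulrC.
Qed.

Lemma smooth_interp (R : realType) k (L : R) (g : 'rV[R]_k -> R)
    (p q : 'rV[R]_k) (t : R) :
    smooth L g -> 0 < t < 1 ->
  g (t *: p + (1 - t) *: q)
    <= t * g p + (1 - t) * g q + L * l2norm (p - q) ^+ 2 / 2 * (t * (1 - t)).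
Proof.
move=> [dg gL].
apply: segment_interp => [z|s s' ss']; first exact: diff_derivable.
rewrite !derive_grad// -dotBl (le_trans (cauchy_schwarz _ _))//.
rewrite expr2 mulrA mulrAC ler_wpM2r ?l2norm_ge0//.
rewrite (le_trans (gL _ _))// opprD addrACA subrr add0r -scalerBl l2normZ.
by rewrite ler0_norm ?subr_le0// opprB mulrA mulrAC.
Qed.

Lemma dot_continuousl (R : realType) k (u : 'rV[R]_k) :
  continuous (fun v : 'rV[R]_k => dot v u).
Proof.
apply: (@continuous_big _ _ _ _ predT add_continuous _ (index_enum 'I_k)
  (fun i (w : 'rV[R]_k) => w ord0 i * u ord0 i)) => i _ w.
apply: (@continuousM _ _ (fun w : 'rV[R]_k => w ord0 i) (fun=> u ord0 i)).
  exact: coord_continuous.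
exact: cst_continuous.
Qed.

Lemma is_derive_dotl (R : realType) k l (G : 'rV[R]_k -> 'rV[R]_l)
    (z d : 'rV[R]_k) (u : 'rV[R]_l) :
  derivable G z d -> is_derive z d (fun z => dot (G z) u) (dot ('D_d G z) u).
Proof.
move=> dG.
have E : (fun h : R => h^-1 *: (((fun z => dot (G z) u) \o shift z) (h *: d)
      - dot (G z) u))
    = (fun v => dot v u) \o (fun h => h^-1 *: ((G \o shift z) (h *: d) - G z)).
  by apply/funext => h /=; rewrite dotZl dotBl.
have cv : h^-1 *: (((fun z => dot (G z) u) \o shift z) (h *: d) - dot (G z) u)
    @[h --> 0^'] --> dot ('D_d G z) u.
  rewrite E; apply: cvg_comp; first exact: dG.
  exact: dot_continuousl.
split; first by apply/cvg_ex; exists (dot ('D_d G z) u).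
exact: cvg_lim cv.
Qed.

(** The mean value theorem is scalar, so [G] is paired with a fixed vector [u]. The choice of [u] is
    left free in order to take later the opposite of the value to be bounded. *)
Lemma jacobian_interp (R : realType) k l (G : 'rV[R]_k -> 'rV[R]_l)
    (p q : 'rV[R]_k) (u : 'rV[R]_l) (K t : R) :
    (forall z, differentiable G z) ->
    (forall s s', s <= s' ->
      l2opnorm (jacobian G (q + s *: (p - q)) - jacobian G (q + s' *: (p - q)))
      <= K * (s' - s)) ->
    0 < t < 1 ->
  dot (G (t *: p + (1 - t) *: q)) u
    <= t * dot (G p) u + (1 - t) * dot (G q) u
       + K * l2norm (p - q) * l2norm u / 2 * (t * (1 - t)).
Proof.
move=> dG GK.
have dGu z := is_derive_dotl u (@diff_derivable _ _ _ G z (p - q) (dG z)).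
apply: (@segment_interp _ _ (fun z => dot (G z) u)) => [z|s s' ss'].
  exact: (@ex_derive _ _ _ _ _ _ _ (dGu z)).
rewrite !(@derive_val _ _ _ _ _ _ _ (dGu _)).
rewrite -dotBl (le_trans (cauchy_schwarz _ _))//.
rewrite mulrAC ler_wpM2r ?l2norm_ge0// !deriveEjacobian// -mulmxBr.
rewrite (le_trans (ler_l2norm_mulmx _ _))// mulrAC ler_wpM2r ?l2norm_ge0//.
exact: GK.
Qed.

(** * The partial gradient and the first-order condition *)

Lemma derive_rshift (R : realType) m n (f : 'rV[R]_m -> 'rV[R]_n -> R)
    (z : 'rV[R]_(m + n)) (i : 'I_n) :
  'D_(delta_mx ord0 (rshift m i)) (joint f) z
  = 'D_(delta_mx ord0 i) (f (lsubmx z)) (rsubmx z).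
Proof.
rewrite /derive; set a := fun _ => _; set b := fun _ => _.
suff -> : a = b by []; apply/funext => h; rewrite /a /b /=.
rewrite /joint; congr (_ *: (f _ _ - _)).
  by apply/rowP => j; rewrite !mxE eqxx eq_lrshift mulr0 add0r.
by apply/rowP => j; rewrite !mxE eq_rshift.
Qed.

Lemma grad_yE (R : realType) m n (f : 'rV[R]_m -> 'rV[R]_n -> R)
    (z : 'rV[R]_(m + n)) :
  grad_y f z = rsubmx (grad (joint f) z).
Proof. by apply/rowP => i; rewrite !mxE derive_rshift. Qed.

(** Fermat's rule on each coordinate line of the y block: x is constant along such a line, so the
    restriction of [joint f] to it is minimal at 0. The interval from -1 to 1 is an arbitrary
    neighbourhood of 0. *)
Lemma grad_y_argmin (R : realType) m n (f : 'rV[R]_m -> 'rV[R]_n -> R)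
    (x : 'rV[R]_m) (y : 'rV[R]_n) :
    (forall z, differentiable (joint f) z) -> argmin (f x) y ->
  grad_y f (row_mx x y) = 0.
Proof.
move=> df ymin; apply/rowP => i; rewrite grad_yE !mxE.
set z := row_mx x y; set d := delta_mx _ _.
have dl (s : R) : is_derive s 1 (fun s : R => joint f (z + s *: d))
    ('D_d (joint f) (z + s *: d)).
  exact/is_derive_line/diff_derivable.
have := @derive1_at_min _ (fun s : R => joint f (z + s *: d)) (-1) 1 0.
case=> [|s _||s _|_ <-].
- lra.
- exact: ex_derive.
- by rewrite in_itv/=; apply/andP; split; lra.
- rewrite scale0r addr0 /joint linearD/= linearZ/= row_mxKl.
  rewrite (_ : lsubmx d = 0) ?scaler0 ?addr0 ?row_mxKr; last first.
    by apply/rowP => j; rewrite !mxE eqxx eq_lrshift.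
  exact: ymin.
- by rewrite derive_val scale0r addr0.
Qed.

Lemma grad_y_lipschitz (R : realType) m n (f : 'rV[R]_m -> 'rV[R]_n -> R)
    (L : R) (z1 z2 : 'rV[R]_(m + n)) :
  smooth L (joint f) ->
  l2norm (grad_y f z1 - grad_y f z2) <= L * l2norm (z1 - z2).
Proof.
by move=> [_ fL]; rewrite !grad_yE -linearB (le_trans (l2norm_rsubmx_le _)).
Qed.

(** * Nearby minimizers from the error bound *)

Lemma argmin_near (R : realType) m n (f : 'rV[R]_m -> 'rV[R]_n -> R)
    (tau : R) (x : 'rV[R]_m) (y : 'rV[R]_n) :
    (forall x, argmin (f x) !=set0 /\ closed (argmin (f x))) ->
    (forall x y,
      l2dist y (argmin (f x)) <= tau * l2norm (grad_y f (row_mx x y))) ->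
  exists2 y', argmin (f x) y'
    & l2norm (y' - y) <= tau * l2norm (grad_y f (row_mx x y)).
Proof.
move=> A2 A3; have [S0 Scl] := A2 x.
by have [y' Sy' y'y] := l2dist_attained y S0 Scl; exists y'; rewrite // y'y.
Qed.

(** [grad_y f] vanishes at (x, y), so at (x', y) its norm is at most L |x' - x|; the error bound at
    x' concludes. *)
Lemma argmin_lipschitz (R : realType) m n (f : 'rV[R]_m -> 'rV[R]_n -> R)
    (L tau : R) (x x' : 'rV[R]_m) (y : 'rV[R]_n) :
    smooth L (joint f) ->
    (forall x, argmin (f x) !=set0 /\ closed (argmin (f x))) ->
    0 < tau ->
    (forall x y,
      l2dist y (argmin (f x)) <= tau * l2norm (grad_y f (row_mx x y))) ->
    argmin (f x) y ->
  exists2 y', argmin (f x') y' & l2norm (y' - y) <= L * tau * l2norm (x' - x).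
Proof.
move=> fL A2 tau0 A3 Sy; have [y' Sy' y'y] := argmin_near x' y A2 A3.
exists y' => //; apply: (le_trans y'y).
rewrite (mulrC L) -mulrA ler_pM2l//.
have := grad_y_lipschitz (row_mx x' y) (row_mx x y) fL.
rewrite (grad_y_argmin (fL.1) Sy) subr0 opp_row_mx add_row_mx subrr.
by rewrite l2norm_row_mx0r.
Qed.

Lemma argmin_chord (R : realType) m n (f : 'rV[R]_m -> 'rV[R]_n -> R)
    (L H tau t : R) (x1 x2 : 'rV[R]_m) (y : 'rV[R]_n) :
    smooth L (joint f) ->
    twice_differentiable (joint f) ->
    (forall x1 x2 y1 y2,
      l2opnorm (jacobian (grad_y f) (row_mx x1 y1)
                - jacobian (grad_y f) (row_mx x2 y2))
      <= H * (l2norm (x1 - x2) + l2norm (y1 - y2))) ->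
    (forall x, argmin (f x) !=set0 /\ closed (argmin (f x))) ->
    0 < tau ->
    (forall x y,
      l2dist y (argmin (f x)) <= tau * l2norm (grad_y f (row_mx x y))) ->
    0 < t < 1 -> argmin (f (t *: x1 + (1 - t) *: x2)) y ->
  exists w y2 : 'rV[R]_n,
    [/\ argmin (f x1) (y + (1 - t) *: w), argmin (f x2) y2,
        l2norm w <= L * tau * l2norm (x1 - x2)
      & l2norm (y2 - (y - t *: w))
        <= H * tau / 2 * t * (l2norm (x1 - x2) + l2norm w) ^+ 2].
Proof.
move=> fL [_ df] fH A2 tau0 A3 /[dup] t01 /andP[t0 t1] Sy.
have u0 : 0 < 1 - t by rewrite subr_gt0.
have [y1 Sy1 y1y] := argmin_lipschitz x1 fL A2 tau0 A3 Sy.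
(* Since [x1] differs from the intermediate point by (1 - t) (x1 - x2), dividing by 1 - t yields a
   bound on [w] that does not depend on t. *)
pose w := (1 - t)^-1 *: (y1 - y).
have y1E : y1 = y + (1 - t) *: w.
  by rewrite scalerA divff ?gt_eqF// scale1r subrKC.
have w_le : l2norm w <= L * tau * l2norm (x1 - x2).
  rewrite l2normZ gtr0_norm ?invr_gt0// ler_pdivrMl// (le_trans y1y)//.
  rewrite (_ : x1 - _ = (1 - t) *: (x1 - x2)); last first.
    by rewrite opprD addrA scalerBr [(1 - t) *: x1]scalerBl scale1r.
  by rewrite l2normZ gtr0_norm// mulrCA.
clearbody w; subst y1.
have [y2 Sy2 y2y] := argmin_near x2 (y - t *: w) A2 A3.
exists w, y2; split => //; apply: (le_trans y2y).
set v := grad_y f _; set D := l2norm (x1 - x2) + _.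
pose p := row_mx x1 (y + (1 - t) *: w); set q := row_mx x2 (y - t *: w) in v *.
have pq : p - q = row_mx (x1 - x2) w.
  rewrite opp_row_mx add_row_mx; congr row_mx.
  by rewrite opprB addrC subrKA -scalerDl subrKC scale1r.
(* The sign of [H] is not assumed; the Jacobian bound for y-arguments [w] and 0 has exactly [H * D]
   on its right, above a nonnegative operator norm. *)
have HD0 : 0 <= H * D.
  have := fH x1 x2 w 0; rewrite subr0; apply: le_trans.
  exact: l2opnorm_ge0.
have dG z : differentiable (grad_y f) z.
  have -> : grad_y f = rsubmx \o grad (joint f).
    by apply/funext => z'; rewrite grad_yE.
  apply: differentiable_comp; first exact: df.
  exact: differentiable_rsubmx.
have GK s s' : s <= s' ->
    l2opnorm (jacobian (grad_y f) (q + s *: (p - q))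
              - jacobian (grad_y f) (q + s' *: (p - q))) <= H * D * (s' - s).
  move=> ss'; rewrite pq !scale_row_mx !add_row_mx (le_trans (fH _ _ _ _))//.
  have dE k (a b : 'rV[R]_k) : a + s *: b - (a + s' *: b) = (s - s') *: b.
    by rewrite opprD addrACA subrr add0r -scalerBl.
  rewrite !dE !l2normZ.
  by rewrite ler0_norm ?subr_le0// opprB -mulrDr -/D mulrA mulrAC.
(* As [grad_y f] is 0 at [p] and at the intermediate point, testing against [- v] leaves (1 - t)
   |v|^2 <= H D |p - q| |v| / 2 t (1 - t). Cancelling 1 - t keeps the factor t in the final
   bound. *)
have := jacobian_interp (- v) dG GK t01.
have -> : t *: p + (1 - t) *: q = row_mx (t *: x1 + (1 - t) *: x2) y.
  rewrite !scale_row_mx add_row_mx; congr row_mx.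
  rewrite scalerDr scalerBr addrACA -scalerDl subrKC scale1r !scalerA.
  by rewrite (mulrC t) subrr addr0.
rewrite (grad_y_argmin fL.1 Sy) (grad_y_argmin fL.1 Sy1).
have vN : dot v (- v) = - l2norm v ^+ 2.
  by rewrite -scaleN1r dotZr mulN1r sqr_l2norm.
rewrite !dot0l mulr0 add0r l2normN pq -/v vN => hv.
have v0 := l2norm_ge0 v.
have N0 := l2norm_ge0 (row_mx (x1 - x2) w).
have ND : l2norm (row_mx (x1 - x2) w) <= D by exact: l2norm_row_mx_le.
move: hv; set N := l2norm (row_mx _ _) in N0 ND *.
set V := l2norm v in v0 * => hv.
have {}hv : V * V <= V * (H * D * D / 2 * t).
  have : H * D * N <= H * D * D by rewrite ler_wpM2l.
  move=> h; rewrite -(ler_pM2l u0).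
  have := ler_wpM2l (mulr_ge0 (mulr_ge0 (ltW t0) (ltW u0)) v0) h; lra.
(* V is cancelled when it is positive; when it is 0, the right side is nonnegative by [HD0]. *)
have {}hv : V <= H * D * D / 2 * t.
  move: v0; rewrite le_eqVlt => /predU1P[<-|v0]; last by rewrite -(ler_pM2l v0).
  apply: mulr_ge0; last exact: ltW.
  by rewrite divr_ge0// mulr_ge0// (le_trans N0 ND).
by have := ler_wpM2l (ltW tau0) hv; lra.
Qed.

(** * Weak convexity of the pessimistic hyper-objective *)

Lemma hyperobjective_interp (R : realType) m n
    (f F : 'rV[R]_m -> 'rV[R]_n -> R) (L_f H_f tau M_F L_F t : R)
    (x1 x2 : 'rV[R]_m) (y : 'rV[R]_n) :
    smooth L_f (joint f) ->
    twice_differentiable (joint f) ->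
    (forall x1 x2 y1 y2,
      l2opnorm (jacobian (grad_y f) (row_mx x1 y1)
                - jacobian (grad_y f) (row_mx x2 y2))
      <= H_f * (l2norm (x1 - x2) + l2norm (y1 - y2))) ->
    (forall x, argmin (f x) !=set0 /\ closed (argmin (f x))) ->
    0 < tau ->
    (forall x y,
      l2dist y (argmin (f x)) <= tau * l2norm (grad_y f (row_mx x y))) ->
    l2lipschitz M_F (joint F) ->
    smooth L_F (joint F) ->
    0 < t < 1 -> x1 != x2 -> argmin (f (t *: x1 + (1 - t) *: x2)) y ->
  let L_S := Num.max (2 * H_f * tau * (1 + 9 * L_f ^+ 2 * tau ^+ 2))
                     (4 * L_f ^+ 2 * tau ^+ 2) in
  let rho := M_F * L_S + L_F * (1 + L_S) in
  exists y1 y2 : 'rV[R]_n, [/\ argmin (f x1) y1, argmin (f x2) y2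
    & F (t *: x1 + (1 - t) *: x2) y <= t * F x1 y1 + (1 - t) * F x2 y2
        + rho / 2 * (t * (1 - t)) * l2norm (x1 - x2) ^+ 2].
Proof.
move=> fL f2 fH A2 tau0 A3 FM FL /[dup] t01 /andP[t0 t1] x12 Sy L_S rho.
have u0 : 0 < 1 - t by rewrite subr_gt0.
have [w [y2 [Sy1 Sy2 w_le y2_le]]] :=
  argmin_chord fL f2 fH A2 tau0 A3 t01 Sy.
exists (y + (1 - t) *: w), y2; split => //.
set y1 := y + _ in Sy1 *; set y2' := y - _ in y2_le.
(* Two distinct points are what reveals the signs of [M_F], [L_F] and [H_f]: each multiplies a
   positive distance in a bound on a nonnegative quantity. *)
have D0 : 0 < l2norm (x1 - x2).
  rewrite lt_neqAle l2norm_ge0 andbT eq_sym; apply: contra x12 => /eqP.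
  by move/l2norm_eq0/eqP; rewrite subr_eq0.
have dx : row_mx x1 (0 : 'rV[R]_n) - row_mx x2 0 = row_mx (x1 - x2) 0.
  by rewrite opp_row_mx add_row_mx subrr.
have M0 : 0 <= M_F.
  rewrite -(pmulr_lge0 _ D0) -(l2norm_row_mx0r n) -dx.
  exact: le_trans (FM _ _).
have L0 : 0 <= L_F.
  rewrite -(pmulr_lge0 _ D0) -(l2norm_row_mx0r n) -dx.
  exact: le_trans (l2norm_ge0 _) (FL.2 _ _).
have H0 : 0 <= H_f.
  have := le_trans (l2opnorm_ge0 _) (fH x1 x2 0 0).
  by rewrite subr0 l2norm0 addr0 pmulr_lge0.
have w0 := l2norm_ge0 w.
have pq : row_mx x1 y1 - row_mx x2 y2' = row_mx (x1 - x2) w.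
  rewrite opp_row_mx add_row_mx; congr row_mx.
  by rewrite opprB addrC subrKA -scalerDl subrKC scale1r.
have pqt : t *: row_mx x1 y1 + (1 - t) *: row_mx x2 y2'
    = row_mx (t *: x1 + (1 - t) *: x2) y.
  rewrite !scale_row_mx add_row_mx; congr row_mx.
  rewrite scalerDr scalerBr addrACA -scalerDl subrKC scale1r !scalerA.
  by rewrite (mulrC t) subrr addr0.
have Fpq := smooth_interp (row_mx x1 y1) (row_mx x2 y2') FL t01.
rewrite pqt pq /joint !row_mxKl !row_mxKr sqr_l2norm_row_mx in Fpq.
have Fy2 : F x2 y2' <= F x2 y2 + M_F * l2norm (y2 - y2').
  have := FM (row_mx x2 y2') (row_mx x2 y2).
  rewrite opp_row_mx add_row_mx subrr l2norm_row_mx0l /joint.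
  rewrite !row_mxKl !row_mxKr -l2normN opprB => /(le_trans (ler_norm _)); lra.
move: D0 w0 w_le y2_le Fpq Fy2.
set D := l2norm (x1 - x2); set W := l2norm w; set E := l2norm (y2 - _).
set a := L_f * tau => D0 w0 w_le y2_le Fpq Fy2.
have LS1 : 2 * H_f * tau * (1 + 9 * a ^+ 2) <= L_S.
  by rewrite /L_S /a exprMn mulrA le_max lexx.
have LS2 : 4 * a ^+ 2 <= L_S.
  by rewrite /L_S /a exprMn mulrA le_max lexx orbT.
have W2 : W ^+ 2 <= a ^+ 2 * D ^+ 2.
  by rewrite -exprMn lerXn2r// nnegrE// (le_trans w0).
have DW2 : (D + W) ^+ 2 <= 2 * (1 + a ^+ 2) * D ^+ 2.
  have := sqr_ge0 (D - W); rewrite !expr2 in W2 *; lra.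
(* First entry of the maximum [L_S]: [y2_le] and [DW2] give H_f tau (1 + a^2) t D^2, while [LS1]
   allows H_f tau (1 + 9 a^2) t D^2; the difference is a nonnegative multiple of the term in
   [h2]. *)
have E_le : E <= L_S / 2 * t * D ^+ 2.
  apply: (le_trans y2_le).
  have HT : 0 <= H_f * tau / 2 * t.
    by apply: mulr_ge0 (ltW t0); rewrite divr_ge0// mulr_ge0// ltW.
  have h1 := ler_wpM2l HT DW2.
  have h2 : 0 <= H_f * tau / 2 * t * (a ^+ 2 * D ^+ 2).
    by rewrite mulr_ge0// mulr_ge0 ?sqr_ge0.
  have h3 := ler_wpM2r (mulr_ge0 (ltW t0) (sqr_ge0 D)) LS1.
  lra.
(* Second entry of the maximum: W^2 <= a^2 D^2 <= 4 a^2 D^2 <= L_S D^2. *)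
have LF : L_F * (D ^+ 2 + W ^+ 2) <= L_F * ((1 + L_S) * D ^+ 2).
  apply: ler_wpM2l => //.
  have := ler_wpM2r (sqr_ge0 D) LS2.
  have : 0 <= a ^+ 2 * D ^+ 2 by rewrite mulr_ge0 ?sqr_ge0.
  lra.
(* The Lipschitz error at [y2'] has weight 1 - t and [E] carries a factor t, so it scales with t (1
   - t) like the smoothness error. The two add up to the terms M_F L_S and L_F (1 + L_S) of
   [rho]. *)
have tu0 := mulr_ge0 (ltW t0) (ltW u0).
have h1 := ler_wpM2l (ltW u0) Fy2.
have h2 := ler_wpM2l (mulr_ge0 (ltW u0) M0) E_le.
have h3 := ler_wpM2l tu0 LF.
rewrite /rho; lra.
Qed.

(** This identity converts the quadratic term in [weakly_convex] into the remainder rho / 2 t (1 -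
    t) |x1 - x2|^2 of [hyperobjective_interp]. *)
Lemma sqr_l2norm_conv (R : realType) k (t : R) (u v : 'rV[R]_k) :
  l2norm (t *: u + (1 - t) *: v) ^+ 2
  = t * l2norm u ^+ 2 + (1 - t) * l2norm v ^+ 2
    - t * (1 - t) * l2norm (u - v) ^+ 2.
Proof.
rewrite -(scaleN1r v) !sqr_l2norm !(dotDl, dotDr, dotZl, dotZr) (dotC v u); ring.
Qed.

Lemma phi_p_ge (R : realType) m n (f F : 'rV[R]_m -> 'rV[R]_n -> R)
    (x : 'rV[R]_m) (y : 'rV[R]_n) :
  phi_p f F x \is a fin_num -> argmin (f x) y -> F x y <= fine (phi_p f F x).
Proof.
by move=> xfin Sy; rewrite -lee_fin fineK//; apply: ereal_sup_ubound; exists y.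
Qed.

(** Nonemptiness of the solution set excludes -oo. For the upper bound, each minimizer over [x] has
    one over [xs] within L_f tau |xs - x|, so F there exceeds the finite value at [xs] by a bounded
    amount. *)
Lemma phi_p_fin_num (R : realType) m n (f F : 'rV[R]_m -> 'rV[R]_n -> R)
    (L_f tau M_F : R) :
    smooth L_f (joint f) ->
    (forall x, argmin (f x) !=set0 /\ closed (argmin (f x))) ->
    0 < tau ->
    (forall x y,
      l2dist y (argmin (f x)) <= tau * l2norm (grad_y f (row_mx x y))) ->
    l2lipschitz M_F (joint F) ->
    (exists xstar : 'rV[R]_m, (phi_p f F xstar < +oo)%E) ->
  forall x : 'rV[R]_m, phi_p f F x \is a fin_num.
Proof.
move=> fL A2 tau0 A3 FM [xs xs_lt].
have gtNy x : (-oo < phi_p f F x)%E.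
  have [[y Sy] _] := A2 x.
  by rewrite (lt_le_trans (ltNyr (F x y)))//; apply: ereal_sup_ubound; exists y.
have xs_fin : phi_p f F xs \is a fin_num by rewrite fin_real// gtNy.
move=> x; rewrite fin_real// gtNy/=.
(* The absolute value of [M_F] spares a sign argument, which would need two distinct points. *)
apply: (@le_lt_trans _ _ (fine (phi_p f F xs)
  + `|M_F| * (l2norm (xs - x) + L_f * tau * l2norm (xs - x)))%:E);
  last exact: ltry.
apply: ge_ereal_sup => _ [y Sy <-]; rewrite lee_fin.
have [y' Sy' y'y] := argmin_lipschitz xs fL A2 tau0 A3 Sy.
have := phi_p_ge xs_fin Sy'; have := FM (row_mx x y) (row_mx xs y').
rewrite /joint !row_mxKl !row_mxKr => /(le_trans (ler_norm _)) h1 h2.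
have : M_F * l2norm (row_mx x y - row_mx xs y')
    <= `|M_F| * (l2norm (xs - x) + L_f * tau * l2norm (xs - x)).
  apply: (le_trans (ler_wpM2r (l2norm_ge0 _) (ler_norm _))).
  apply: ler_wpM2l => //.
  rewrite -l2normN opprB opp_row_mx add_row_mx.
  by rewrite (le_trans (l2norm_row_mx_le _ _))// lerD2l.
lra.
Qed.

Lemma phi_p_weakly_convex (R : realType) m n
    (f F : 'rV[R]_m -> 'rV[R]_n -> R) (L_f H_f tau M_F L_F : R) :
    smooth L_f (joint f) ->
    twice_differentiable (joint f) ->
    (forall x1 x2 y1 y2,
      l2opnorm (jacobian (grad_y f) (row_mx x1 y1)
                - jacobian (grad_y f) (row_mx x2 y2))
      <= H_f * (l2norm (x1 - x2) + l2norm (y1 - y2))) ->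
    (forall x, argmin (f x) !=set0 /\ closed (argmin (f x))) ->
    0 < tau ->
    (forall x y,
      l2dist y (argmin (f x)) <= tau * l2norm (grad_y f (row_mx x y))) ->
    l2lipschitz M_F (joint F) ->
    smooth L_F (joint F) ->
    (forall x, phi_p f F x \is a fin_num) ->
  let L_S := Num.max (2 * H_f * tau * (1 + 9 * L_f ^+ 2 * tau ^+ 2))
                     (4 * L_f ^+ 2 * tau ^+ 2) in
  weakly_convex (M_F * L_S + L_F * (1 + L_S)) (fun x => fine (phi_p f F x)).
Proof.
move=> fL f2 fH A2 tau0 A3 FM FL pfin L_S t x1 x2 _ _.
(* The degenerate cases are set aside because [hyperobjective_interp] assumes distinct endpoints and
   t strictly between 0 and 1. *)
have [->|x12] := eqVneq x1 x2; first by rewrite !convmm.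
have [->|t0] := eqVneq t 0%:i01; first by rewrite !conv0.
have [->|t1] := eqVneq t 1%:i01; first by rewrite !conv1.
have {t0 t1}t01 : 0 < t%:num < 1.
  by rewrite !lt_neqAle eq_sym t0 t1 ge0 le1.
rewrite convRE.
rewrite (_ : conv t x1 x2 = t%:num *: x1 + (1 - t%:num) *: x2)//.
rewrite sqr_l2norm_conv; rewrite /unstable.onem.
set rho := M_F * L_S + _; set xt : 'rV[R]_m := t%:num *: x1 + _.
suff : fine (phi_p f F xt) <= t%:num * fine (phi_p f F x1)
    + (1 - t%:num) * fine (phi_p f F x2)
    + rho / 2 * (t%:num * (1 - t%:num)) * l2norm (x1 - x2) ^+ 2 by lra.
(* The supremum need not be attained, so every [y] over the intermediate point is bounded
   separately. *)
rewrite -lee_fin fineK//; apply: ge_ereal_sup => _ [y Sy <-]; rewrite lee_fin.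
have [y1 [y2 [Sy1 Sy2 le12]]] :=
  hyperobjective_interp fL f2 fH A2 tau0 A3 FM FL t01 x12 Sy.
apply: (le_trans le12); rewrite lerD2r; case/andP: t01 => t0 t1.
apply: lerD; apply: ler_wpM2l; rewrite ?subr_ge0 ?(ltW t0) ?(ltW t1)//.
  exact: phi_p_ge.
exact: phi_p_ge.
Qed.

(** * Reduction of the optimistic case to the pessimistic one *)

Lemma phi_oE (R : realType) m n (f F : 'rV[R]_m -> 'rV[R]_n -> R)
    (x : 'rV[R]_m) :
  phi_o f F x = (- phi_p f (fun x y => (- F x y)%R) x)%E.
Proof.
(* [ereal_inf] is by definition the opposite of the [ereal_sup] of the opposites. *)
by rewrite /phi_o /phi_p /ereal_inf image_comp.
Qed.

Lemma smoothN (R : realType) k (L : R) (g : 'rV[R]_k -> R) :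
  smooth L g -> smooth L (fun z => - g z).
Proof.
move=> [dg gL]; split => [z|z1 z2]; first exact: differentiableN.
have gradN z : grad (fun z => - g z) z = - grad g z.
  by apply/rowP => i; rewrite !mxE deriveN//; exact: diff_derivable.
by rewrite !gradN -opprD l2normN.
Qed.

Lemma l2lipschitzN (R : realType) k (M : R) (g : 'rV[R]_k -> R) :
  l2lipschitz M g -> l2lipschitz M (fun z => - g z).
Proof. by move=> gM z1 z2; rewrite -opprD normrN. Qed.

Theorem theorem3 (R : realType) (m n : nat)
  (f F : 'rV[R]_m -> 'rV[R]_n -> R) (L_f H_f tau M_F L_F : R)
  (A1_smooth : smooth L_f (joint f))
  (A1_twice : twice_differentiable (joint f))
  (A1_hess : forall (x1 x2 : 'rV[R]_m) (y1 y2 : 'rV[R]_n),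
     l2opnorm (jacobian (grad_y f) (row_mx x1 y1)
               - jacobian (grad_y f) (row_mx x2 y2))
     <= H_f * (l2norm (x1 - x2) + l2norm (y1 - y2)))
  (A2 : forall x : 'rV[R]_m,
     [/\ argmin (f x) !=set0, closed (argmin (f x))
       & convex_set (argmin (f x))])
  (tau_gt0 : 0 < tau)
  (A3 : forall (x : 'rV[R]_m) (y : 'rV[R]_n),
     l2dist y (argmin (f x)) <= tau * l2norm (grad_y f (row_mx x y)))
  (B1_lipschitz : l2lipschitz M_F (joint F))
  (B1_smooth : smooth L_F (joint F)) :
  let L_S := Num.max (2 * H_f * tau * (1 + 9 * L_f ^+ 2 * tau ^+ 2))
                     (4 * L_f ^+ 2 * tau ^+ 2) in
  let rho := M_F * L_S + L_F * (1 + L_S) in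
  ((exists xstar : 'rV[R]_m, (-oo < phi_o f F xstar)%E) ->
     (forall x : 'rV[R]_m, phi_o f F x \is a fin_num) /\
     weakly_concave rho (fun x => fine (phi_o f F x)))
  /\
  ((exists xstar : 'rV[R]_m, (phi_p f F xstar < +oo)%E) ->
     (forall x : 'rV[R]_m, phi_p f F x \is a fin_num) /\
     weakly_convex rho (fun x => fine (phi_p f F x))).
Proof.
have {}A2 x : argmin (f x) !=set0 /\ closed (argmin (f x)).
  by have [] := A2 x.
move=> L_S rho; split=> [[xs]|xs_lt]; last first.
  have pfin := phi_p_fin_num A1_smooth A2 tau_gt0 A3 B1_lipschitz xs_lt.
  by split => //; exact: phi_p_weakly_convex.
have NFM := l2lipschitzN B1_lipschitz.
have NFL := smoothN B1_smooth.
(* The lower finiteness of [phi_o] at [xs] becomes the upper finiteness of [phi_p] for -F. *)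
rewrite phi_oE lteNr => xs_lt.
have pfin := phi_p_fin_num A1_smooth A2 tau_gt0 A3 NFM (ex_intro _ xs xs_lt).
split=> [x|]; first by rewrite phi_oE fin_numN.
(* The sign in [weakly_concave] cancels the one in [phi_oE]; [rho] is unchanged since -F has the
   same constants as F. *)
rewrite /weakly_concave (_ : (fun x => _) = fun x =>
    fine (phi_p f (fun x y => - F x y) x)); last first.
  by apply/funext => x; rewrite phi_oE fineN opprK.
exact: phi_p_weakly_convex.
Qed.
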